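(* Let $\mathbf{X}_n$, $n\in\mathbb{Z}_+$, be a subcritical $p$-type Galton--Watson process (with immigration, as defined in the context), and let $\mathcal{C}\subseteq\mathbb{Z}_+^p$ be its unique communication class that is reached in finitely many steps with probability 1 for any initial distribution. Then $\mathcal{C}$ is a subset of a lower dimensional affine subspace of $\mathbb{R}^p$ (i.e. an affine subspace of dimension less than $p$) if and only if at least one of the following conditions holds: (i) At least one of the types $1,\dots,p$ dies out. (ii) There exists a vector $\mathbf{c}\in\mathbb{R}^p$, $\mathbf{c}\ne\mathbf{0}$, such that $\mathbf{c}^\top\boldsymbol{\xi}_i(1,1)=0$ almost surely for every type $i=1,\dots,p$, and the random variable $\mathbf{c}^\top\boldsymbol{\eta}(1)$ is degenerate (almost surely constant). Moreover, if type $i$ dies out, then $\mathcal{C}$ is a subset of the linear space $\{\mathbf{x}\in\mathbb{R}^p:\mathbf{e}_i^\top\mathbf{x}=0\}$, where $\mathbf{e}_i$ is the $i$-th canonical basis vector; and if (ii) holds with the vector $\mathbf{c}$, then $\mathcal{C}$ is a subset of the affine subspace $\{\mathbf{x}\in\mathbb{R}^p:\mathbf{c}^\top\mathbf{x}=\mathbf{c}^\top\boldsymbol{\eta}(1)\}$, where $\mathbf{c}^\top\boldsymbol{\eta}(1)$ stands for its almost sure constant value.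
   Context: $\mathbb{Z}_+$ is the set of nonnegative integers and $p$ is a positive integer. A $p$-type Galton--Watson process $\mathbf{X}_n=(X_{n,1},\dots,X_{n,p})^\top$, $n\in\mathbb{Z}_+$, is a $\mathbb{Z}_+^p$-valued Markov chain defined by the recursion $$\mathbf{X}_n=\sum_{i=1}^p\sum_{k=1}^{X_{n-1,i}}\boldsymbol{\xi}_i(n,k)+\boldsymbol{\eta}(n),\qquad n=1,2,\dots,$$ where the $\mathbb{Z}_+^p$-valued random vectors $\mathbf{X}_0$, $\boldsymbol{\xi}_i(n,k)$, $\boldsymbol{\eta}(n)$ ($i=1,\dots,p$; $n,k=1,2,\dots$) are independent of each other; for each $i$ the offspring variables $\boldsymbol{\xi}_i(n,k)$, $n,k\ge1$, are identically distributed; and the innovation variables $\boldsymbol{\eta}(n)$, $n\ge1$, are identically distributed. (The components of a single offspring or innovation vector may be dependent.) Standing assumption: all offspring variables have finite expectation. The mean matrix is $\mathbf{M}=[E\boldsymbol{\xi}_1(1,1),\dots,E\boldsymbol{\xi}_p(1,1)]^\top$ (so $M_{i,j}$ is the expectation of the $j$-th component of $\boldsymbol{\xi}_i(1,1)$), $\varrho(\mathbf{M})$ is its spectral radius, and the process is called subcritical if $\varrho(\mathbf{M})<1$. $M^{(n)}_{i,j}$ denotes the $(i,j)$-th entry of $\mathbf{M}^n$ (with $\mathbf{M}^0$ the identity matrix), and $\eta_j(n)$ denotes the $j$-th component of $\boldsymbol{\eta}(n)$. Known fact used to define $\mathcal{C}$: every subcritical $p$-type Galton--Watson process has exactly one communication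 class $\mathcal{C}\subseteq\mathbb{Z}_+^p$ that is reached in finitely many steps with probability 1 for any initial distribution; it is aperiodic and it is the only closed communication class. A type $i$ is said to die out if $P(\eta_j(1)=0)=1$ for every type $j$ for which there exists a nonnegative integer $n$ with $M^{(n)}_{j,i}>0$. *)

(* Defs.v *)
From HB Require Import structures.
From mathcomp Require Import all_boot all_order all_algebra.
From mathcomp Require Import all_classical all_reals all_analysis.
From mathcomp Require Import complex.
Import Order.TTheory GRing.Theory Num.Theory.
Import numFieldNormedType.Exports.

Set Implicit Arguments.
Unset Strict Implicit.
Unset Printing Implicit Defensive.

Local Open Scope classical_set_scope.
Local Open Scope ring_scope.

(* Z_+^p is 'cV[nat]_p. It is countable, so its product sigma-algebra is the
   discrete one. *)
HB.instance Definition _ (p : nat) :=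
  @isMeasurable.Build default_measure_display 'cV[nat]_p
    (@discrete_measurable 'cV[nat]_p) discrete_measurable0
    discrete_measurableC discrete_measurableU.

Definition mutually_independent {d d'} {T : measurableType d}
    {S : measurableType d'} {R : realType} (P : probability T R)
    {I : eqType} (X : I -> {RV P >-> S}) : Prop :=
  forall (J : seq I) (A : I -> set S), uniq J ->
    (forall i, i \in J -> measurable (A i)) ->
    P (\bigcap_(i in [set` J]) (X i @^-1` A i)) =
    (\prod_(i <- J) P (X i @^-1` A i))%E.

(* The two variables may live on different probability spaces. *)
Definition same_law {d1 d2 d'} {T1 : measurableType d1}
    {T2 : measurableType d2} {S : measurableType d'} {R : realType}
    {P1 : probability T1 R} {P2 : probability T2 R}
    (X : {RV P1 >-> S}) (Y : {RV P2 >-> S}) : Prop :=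
  forall A : set S, measurable A ->
    distribution P1 X A = distribution P2 Y A.

Definition degenerate {d} {T : measurableType d} {R : realType}
    (P : probability T R) (Y : T -> R) : Prop :=
  exists a : R, {ae P, forall w, Y w = a}.

Definition mean_coord {d} {T : measurableType d} {R : realType}
    {P : probability T R} {p : nat} (Y : {RV P >-> 'cV[nat]_p}) (j : 'I_p) :
    \bar R :=
  'E_P[(fun w => (Y w j 0)%:R)%R]%E.

Definition spectral_radius {R : realType} {p : nat} (M : 'M[R]_p) : R :=
  sup [set ComplexField.Normc.normc z | z in
        [set z : R[i] | eigenvalue (map_mx (real_complex R) M) z]].

Definition dotp {R : realType} {p : nat} (c x : 'cV[R]_p) : R :=
  (c^T *m x) 0 0.

Definition real_vec (R : realType) {p : nat} (x : 'cV[nat]_p) : 'cV[R]_p :=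
  map_mx (fun m : nat => m%:R) x.

Definition affine_subspace {R : realType} {p : nat} (a : 'cV[R]_p)
    (V : {vspace 'cV[R]_p}) : set 'cV[R]_p :=
  [set x | x - a \in V].

Definition in_lower_dim_affine {R : realType} {p : nat}
    (D : set 'cV[R]_p) : Prop :=
  exists (a : 'cV[R]_p) (V : {vspace 'cV[R]_p}),
    (\dim V < p)%N /\ D `<=` affine_subspace a V.

(* Generations and individuals are numbered from 0: [offspring i n k] is
   xi_i(n+1, k+1) and [innovation n] is eta(n+1). *)
Definition gw_family {d} {T : measurableType d} {R : realType}
    {P : probability T R} {p : nat} (X0 : {RV P >-> 'cV[nat]_p})
    (xi : 'I_p -> nat -> nat -> {RV P >-> 'cV[nat]_p})
    (eta : nat -> {RV P >-> 'cV[nat]_p})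
    (s : unit + 'I_p * nat * nat + nat) : {RV P >-> 'cV[nat]_p} :=
  match s with
  | inl (inl _) => X0
  | inl (inr (i, n, k)) => xi i n k
  | inr n => eta n
  end.

Record galton_watson {d} {T : measurableType d} {R : realType}
    (P : probability T R) (p : nat) := GaltonWatson {
  init : {RV P >-> 'cV[nat]_p};
  offspring : 'I_p -> nat -> nat -> {RV P >-> 'cV[nat]_p};
  innovation : nat -> {RV P >-> 'cV[nat]_p};
  gw_independent :
    mutually_independent (gw_family init offspring innovation);
  offspring_same_law : forall i n k,
    same_law (offspring i n k) (offspring i 0%N 0%N);
  innovation_same_law : forall n,
    same_law (innovation n) (innovation 0%N);
  offspring_finite_mean : forall i n k j,
    (mean_coord (offspring i n k) j < +oo)%E
}.

Section GaltonWatson.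
Context {d} {T : measurableType d} {R : realType} {P : probability T R}.
Context {p : nat}.
Variable X : galton_watson P p.

Fixpoint gw_from (x0 : T -> 'cV[nat]_p) (n : nat) (w : T) : 'cV[nat]_p :=
  if n is m.+1 then
    \sum_(i < p) \sum_(k < gw_from x0 m w i 0) offspring X i m k w
      + innovation X m w
  else x0 w.

Definition gw_process : nat -> T -> 'cV[nat]_p := gw_from (init X).

Definition mean_matrix : 'M[R]_p :=
  \matrix_(i, j) fine (mean_coord (offspring X i 0%N 0%N) j).

Definition subcritical : Prop := spectral_radius mean_matrix < 1.

(* P(X_n = y | X_0 = x). By independence of X_0 from the offspring and
   innovation variables, this is the law of the process restarted at x. *)
Definition transition_prob (n : nat) (x y : 'cV[nat]_p) : \bar R :=
  P [set w | gw_from (cst x) n w = y].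

Definition accessible (x y : 'cV[nat]_p) : Prop :=
  exists n : nat, (0 < transition_prob n x y)%E.

Definition communicate (x y : 'cV[nat]_p) : Prop :=
  accessible x y /\ accessible y x.

Definition communication_class (C : set 'cV[nat]_p) : Prop :=
  exists x : 'cV[nat]_p, C = [set y | communicate x y].

Definition dies_out (i : 'I_p) : Prop :=
  forall j : 'I_p, (exists n : nat, 0 < (mean_matrix ^+ n) j i) ->
    P [set w | innovation X 0%N w j 0 = 0%N] = 1%E.

Definition degenerate_direction (c : 'cV[R]_p) : Prop :=
  [/\ c != 0,
      forall i, {ae P, forall w,
        dotp c (real_vec R (offspring X i 0%N 0%N w)) = 0}
    & degenerate P (fun w => dotp c (real_vec R (innovation X 0%N w)))].

End GaltonWatson.

(* "For any initial distribution": Y ranges over the processes, on any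
   probability space, which have the offspring and innovation laws of X but
   an arbitrary initial law. *)
Definition reached_from_any_initial_law {d} {T : measurableType d}
    {R : realType} {P : probability T R} {p : nat} (X : galton_watson P p)
    (C : set 'cV[nat]_p) : Prop :=
  forall (d' : measure_display) (T' : measurableType d')
    (Q : probability T' R) (Y : galton_watson Q p),
    (forall i, same_law (offspring Y i 0%N 0%N) (offspring X i 0%N 0%N)) ->
    same_law (innovation Y 0%N) (innovation X 0%N) ->
    Q [set w | exists n : nat, C (gw_process Y n w)] = 1%E.

(* Main.v *)
Require Import Defs.
From mathcomp Require Import all_boot all_order all_algebra.
From mathcomp Require Import all_classical all_reals all_analysis.
From mathcomp Require Import measurable_realfun complex.
Import Order.TTheory GRing.Theory Num.Theory.
Import numFieldNormedType.Exports.

Set Implicit Arguments.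
Unset Strict Implicit.
Unset Printing Implicit Defensive.

Local Open Scope classical_set_scope.
Local Open Scope ring_scope.

(** A state y is accessible from x iff some choice of vectors in the supports
    of the offspring and innovation laws leads from x to y.  The class C is
    closed under such steps and reachable from every state, so it lies in every
    nonempty set closed under steps; this confines C when a type dies out.  If
    (ii) holds, a single step already leads into the hyperplane.

    Conversely, let c.x be constant on C, c <> 0, and let no type die out.  Each
    type i is then present in some state of C; replacing the offspring vectors
    of that state's type-i individuals shows that c.xi_i is almost surely
    constant, equal to (M c)_i, and likewise that c.eta is constant.  Comparing
    two states of C one step later, (M c).x is constant on C as well.  Since C
    consists of integer vectors, c may be taken integral; then every M^n c is
    integral, being a value of c.xi_i, and M^n c tends to 0 by subcriticality.
    Hence M^n c = 0 for some n, and the last nonzero M^n c satisfies (ii). *)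

(** * Linear algebra *)

Lemma exists_kernel_col (F : fieldType) (m n : nat) (D : 'M[F]_(m, n)) :
  (\rank D < n)%N -> exists2 c : 'cV[F]_n, c != 0 & D *m c = 0.
Proof.
move=> rD; have cD0 : cokermx D != 0.
  by rewrite cokermx_eq0 -col_leq_rank -ltnNge.
have [j cj] : exists j, col j (cokermx D) != 0.
  apply/existsP; apply: contra_neqT cD0 => /existsPn c0; apply/matrixP => i j.
  by have := c0 j; rewrite negbK => /eqP/colP/(_ i); rewrite !mxE.
by exists (col j (cokermx D)) => //; rewrite colE mulmxA mulmx_coker mul0mx.
Qed.

Lemma rat_vec_common_denominator (F : archiNumFieldType) (n : nat)
    (c : 'cV[rat]_n) :
  exists2 k : F, k != 0 & forall i, k * ratr (c i 0) \is a Num.int.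
Proof.
exists (\prod_i (denq (c i 0))%:~R).
  by apply/prodf_neq0 => i _; rewrite intr_eq0 denq_neq0.
move=> i; rewrite (bigD1 i)//= mulrAC.
rewrite rpredM//; last by apply: rpred_prod => j _; rewrite intr_int.
rewrite /ratr mulrCA mulfV ?mulr1 ?intr_int//.
by rewrite intr_eq0 denq_neq0.
Qed.

(* The rank of a rational matrix does not change over a larger field, and a
   finite matrix of vectors of D of maximal rank has the same kernel as D. *)
Lemma integer_relation (F : archiNumFieldType) (n : nat) (D : set 'cV[rat]_n)
    (c : 'cV[F]_n) :
  c != 0 -> (forall v, D v -> (map_mx ratr v)^T *m c = 0) ->
  exists c' : 'cV[F]_n,
    [/\ c' != 0, forall i, c' i 0 \is a Num.int &
        forall v, D v -> (map_mx ratr v)^T *m c' = 0].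
Proof.
move=> c0 Dc.
pose A k := `[< exists m, exists2 B : 'M[rat]_(m, n),
  (forall i, D (row i B)^T) & \rank B = k >].
have A0 : exists k, A k.
  by exists 0%N; apply/asboolP; exists 0%N, 0; rewrite ?mxrank0// => -[].
have Ale k : A k -> (k <= n)%N.
  by move=> /asboolP[m [B _ <-]]; exact: rank_leq_col.
case: (ex_maxnP A0 Ale) => k /asboolP[m [B DB rB]] kmax.
have Bker v : D v -> (v^T <= B)%MS.
  move=> Dv; have /kmax : A (\rank (col_mx v^T B)).
    apply/asboolP; exists (1 + m)%N, (col_mx v^T B) => // i.
    case: (split_ordP i) => j ->.
      by rewrite rowKu row_id trmxK.
    by rewrite rowKd; exact: DB.
  rewrite -rB => rle.
  have sB : (B <= col_mx v^T B)%MS by rewrite -addsmxE addsmxSr.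
  have /andP[_ ]: (B == col_mx v^T B)%MS.
    by rewrite -(mxrank_leqif_eq sB) eqn_leq mxrankS.
  by apply: submx_trans; rewrite -addsmxE addsmxSl.
(* If k = n, then B has full column rank over F as well, so B c = 0 contradicts c <> 0. If k < n, a
   rational kernel vector of B, cleared of denominators, is the relation sought. *)
have [kn|kn] := ltnP k n; last first.
  have Bc : map_mx ratr B *m c = 0.
    apply/row_matrixP => i; rewrite row_mul row0.
    have := Dc _ (DB i); rewrite map_trmx trmxK => <-.
    by rewrite map_row.
  have /row_fullP[B' BB'] : row_full (map_mx (ratr : rat -> F) B).
    by rewrite -col_leq_rank mxrank_map rB.
  by move: c0; rewrite -[c]mul1mx -BB' -mulmxA Bc mulmx0 eqxx.
have [e e0 Be] := exists_kernel_col (etrans (congr1 (fun x => x < n)%N rB) kn).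
have [q q0 qe] := rat_vec_common_denominator F e.
exists (q *: map_mx ratr e); split.
- rewrite scaler_eq0 negb_or q0 /=; apply: contra_neq e0 => e0.
  by apply/(@map_mx_inj _ _ (ratr : rat -> F)); rewrite e0 map_mx0.
- by move=> i; rewrite !mxE.
- move=> v /Bker/submxP[u vu]; rewrite map_trmx vu -scalemxAr -map_mxM.
  by rewrite -mulmxA Be mulmx0 map_mx0 scaler0.
Qed.

(** * Decay of the powers of a subcritical matrix *)

Lemma affine_recurrence_cvg0 (R : realType) (q : R) (a e : R^nat) :
  0 <= q < 1 -> (forall n, 0 <= a n) ->
  (forall n, a n.+1 <= q * a n + e n) ->
  (e @ \oo --> 0) -> a @ \oo --> 0.
Proof.
move=> /andP[q0 q1] a0 ae /cvgrPdist_le e0.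
apply/cvgrPdist_le => eps eps0.
(* With this bound on e, the map t |-> q t + eps / 2 * (1 - q) has fixed point eps / 2, so the
   excess of a over eps / 2 shrinks by the factor q at each step. *)
have r0 : 0 < eps / 2 * (1 - q) by rewrite mulr_gt0 ?divr_gt0 ?subr_gt0.
have [N _ HN] := e0 _ r0.
have bnd k : a (N + k)%N <= q ^+ k * a N + eps / 2.
  elim: k => [|k IH].
    by rewrite addn0 expr0 mul1r lerDl divr_ge0// ltW.
  rewrite addnS (le_trans (ae _))//.
  have := HN (N + k)%N (leq_addr _ _).
  rewrite sub0r normrN => /(le_trans (ler_norm _)) ek.
  rewrite (le_trans (lerD (ler_wpM2l q0 IH) ek))//.
  rewrite exprS mulrDr (mulrA q (q ^+ k)) -addrA lerD2l mulrBr mulr1 (mulrC q).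
  by rewrite addrC subrK.
have : (fun k => q ^+ k * a N) @ \oo --> (0 : R).
  rewrite -(mul0r (a N)); apply: cvgM; last exact: cvg_cst.
  by apply: cvg_expr; rewrite ger0_norm.
move=> /cvgrPdist_le/(_ _ (divr_gt0 eps0 (ltr0n _ 2)))[K _ HK].
exists (N + K)%N => // n /= NKn.
rewrite sub0r normrN ger0_norm//.
have Nn : (N <= n)%N := leq_trans (leq_addr _ _) NKn.
rewrite -(subnKC Nn) (le_trans (bnd _))//.
rewrite [leRHS]splitr lerD2r.
have /HK : (K <= n - N)%N by rewrite leq_subRL// ?(leq_trans (leq_addr _ _) NKn).
by rewrite sub0r normrN; apply: le_trans; exact: ler_norm.
Qed.

Local Notation normc := (@ComplexField.Normc.normc _).

Lemma normc_real (R : rcfType) (x : R) : normc (x%:C)%C = `|x|.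
Proof. by rewrite /= expr0n /= addr0 sqrtr_sqr. Qed.

Lemma normc_ge0 (R : rcfType) (z : R[i]) : 0 <= normc z.
Proof. by case: z => a b; exact: sqrtr_ge0. Qed.

(** The point is that the set under [sup] is bounded: eigenvalues are roots of the characteristic
    polynomial, and the sum of the moduli of its roots is an upper bound. *)
Lemma eigenvalue_le_spectral_radius (R : realType) (p : nat) (M : 'M[R]_p)
    (z : R[i]) :
  eigenvalue (map_mx (real_complex R) M) z -> normc z <= spectral_radius M.
Proof.
move=> ez; apply: ub_le_sup; last by exists z.
have [r Mr] := closed_field_poly_normal (char_poly (map_mx (real_complex R) M)).
exists (\sum_(x <- r) normc x) => _ [x /= ex <-].
have xr : x \in r.
  move: ex; rewrite eigenvalue_root_char Mr rootZ ?root_prod_XsubC//.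
  by rewrite (monicP (char_poly_monic _)) oner_eq0.
by rewrite (big_rem x)//= lerDl sumr_ge0// => ? _; exact: normc_ge0.
Qed.

(* Each factor A - z with |z| < 1 can be cancelled, since the entries u_n of
   A^n B satisfy u_(n+1) = z u_n + o(1). *)
Lemma cancel_contracting_factors (R : realType) (p : nat) (A : 'M[R[i]]_p.+1)
    (s : seq R[i]) (B : 'M[R[i]]_p.+1) :
  {in s, forall z, normc z < 1} ->
  (\prod_(z <- s) (A - z%:M)) * B = 0 ->
  forall i j, (fun n => normc ((A ^+ n * B) i j)) @ \oo --> (0 : R).
Proof.
(* The hypothesis is weakened from being zero to tending to zero, so that the induction on s can
   remove one factor at a time. *)
suff H : {in s, forall z, normc z < 1} ->
  (forall i j, (fun n => normc ((A ^+ n * (\prod_(z <- s) (A - z%:M) * B)) i j))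
     @ \oo --> (0 : R)) ->
  forall i j, (fun n => normc ((A ^+ n * B) i j)) @ \oo --> (0 : R).
  move=> s1 s0; apply: H => // i j; rewrite s0.
  under eq_fun => n do rewrite mulr0 mxE ComplexField.Normc.normc0.
  exact: cvg_cst.
elim: s B => [|z s IH] B s1 H i j.
  by move: (H i j); rewrite big_nil; under eq_fun => n do rewrite mul1r.
apply: (@affine_recurrence_cvg0 _ (normc z) _
  (fun n => normc ((A ^+ n * ((A - z%:M) * B)) i j))).
- by rewrite normc_ge0 s1 ?mem_head.
- by move=> n; exact: normc_ge0.
- move=> n; rewrite -ComplexField.Normc.normcM.
  apply: le_trans (le_normcD _ _); rewrite le_eqVlt; apply/orP; left.
  apply/eqP; congr normc.
  suff -> : A ^+ n.+1 * B = A ^+ n * ((A - z%:M) * B) + z *: (A ^+ n * B).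
    by rewrite addrC [LHS]mxE; congr (_ + _); rewrite mxE.
  have -> : A ^+ n * ((A - z%:M) * B) = A ^+ n.+1 * B - z *: (A ^+ n * B).
    by rewrite mulrBl mulrBr mulrA -exprSr [z%:M * B]mul_scalar_mx -scalerAr.
  by rewrite subrK.
- apply: IH => [x xs|k l]; first by rewrite s1// inE xs orbT.
  have := H k l; rewrite big_cons.
  have -> : (A - z%:M) * (\prod_(j0 <- s) (A - j0%:M)) * B =
     \prod_(j0 <- s) (A - j0%:M) * ((A - z%:M) * B) => //.
  rewrite mulrA; congr (_ * _); apply: commr_prod => x _.
  apply: commrB; last exact: comm_mx_scalar.
  by apply/commr_sym/commrB => //; exact: comm_mx_scalar.
Qed.

(** By Cayley-Hamilton, the product of A - z over the roots z of the characteristic polynomial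
    vanishes, and each root is an eigenvalue of modulus below 1; the factors are cancelled with B =
    1. *)
Lemma subcritical_powers_cvg0 (R : realType) (p : nat) (M : 'M[R]_p) :
  spectral_radius M < 1 ->
  forall i j, (fun n => (M ^+ n) i j) @ \oo --> (0 : R).
Proof.
case: p M => [|p] M rM i j; first by case: i.
apply/norm_cvg0P.
pose A := map_mx (real_complex R) M.
have [r Mr] := closed_field_poly_normal (char_poly A).
move: Mr; rewrite (monicP (char_poly_monic _)) scale1r => Mr.
under eq_fun => n.
  rewrite -normc_real.
  have -> : ((M ^+ n) i j)%:C%C = (A ^+ n * 1) i j.
    by rewrite mulr1 -rmorphXn mxE.
  over.
apply: (@cancel_contracting_factors _ _ _ r) => [z zr|].
  apply: le_lt_trans rM; apply: eigenvalue_le_spectral_radius.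
  by rewrite eigenvalue_root_char Mr root_prod_XsubC.
rewrite mulr1; have := Cayley_Hamilton A; rewrite Mr rmorph_prod/= => <-.
by apply: eq_bigr => z _; rewrite rmorphB /= horner_mx_X horner_mx_C.
Qed.

Lemma mulmx_powers_cvg0 (R : realType) (p : nat) (M : 'M[R]_p) (c : 'cV[R]_p) :
  spectral_radius M < 1 ->
  forall i, (fun n => (M ^+ n *m c) i 0) @ \oo --> (0 : R).
Proof.
move=> rM i; under eq_fun => n do rewrite mxE.
suff : (fun n => \sum_j (M ^+ n) i j * c j 0) @ \oo --> \sum_(j < p) (0 : R).
  by rewrite big1_eq.
apply: cvg_big => [|j _]; [exact: add_continuous|rewrite -(mul0r (c j 0))].
by apply: cvgM; [exact: subcritical_powers_cvg0|exact: cvg_cst].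
Qed.

(** The entries tend to 0, and an integer of absolute value below 1 is 0. *)
Lemma integer_powers_eventually0 (R : realType) (p : nat) (M : 'M[R]_p)
    (c : 'cV[R]_p) :
  spectral_radius M < 1 -> (forall n i, (M ^+ n *m c) i 0 \is a Num.int) ->
  exists n, M ^+ n *m c = 0.
Proof.
move=> rM Mint.
have : \forall n \near \oo, forall i, `|(M ^+ n *m c) i 0| < 1.
  apply: filter_forall => i.
  have /cvgrPdist_lt/(_ 1 ltr01) := mulmx_powers_cvg0 c rM i.
  by apply: filterS => n; rewrite sub0r normrN.
case=> n _ /(_ n (leqnn n)) H; exists n; apply/colP => i; rewrite [RHS]mxE.
apply/eqP; have := H i; apply: contraTT => c0.
by rewrite -leNgt norm_intr_ge1.
Qed.

(** * Random vectors with values in a countable set *)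

Definition discrete_measurable_fun {d} {T : measurableType d} {U : Type}
  (f : T -> U) : Prop := forall A : set U, measurable (f @^-1` A).

Section DiscreteMeasurable.
Context {d : measure_display} {T : measurableType d}.

Lemma discrete_measurable_cst (U : Type) (u : U) :
  discrete_measurable_fun (fun _ : T => u).
Proof. by move=> A; rewrite preimage_cst; case: ifP. Qed.

(** Split according to the countably many values of f. This handles the random number of summands in
    a generation. *)
Lemma discrete_measurable_bind (U : countType) (V : Type) (f : T -> U)
    (F : U -> T -> V) :
  discrete_measurable_fun f -> (forall u, discrete_measurable_fun (F u)) ->
  discrete_measurable_fun (fun w => F (f w) w).
Proof.
move=> mf mF A.
rewrite (_ : _ @^-1` A = \bigcup_u (f @^-1` [set u] `&` F u @^-1` A)).
  apply: countable_bigcupT_measurable => [|u]; first exact: countableP.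
  by apply: measurableI; [exact: mf|exact: mF].
apply/seteqP; split => w /=; first by move=> Aw; exists (f w) => //; split.
by case=> u _ [/= <-].
Qed.

Lemma discrete_measurable_add (p : nat) (f g : T -> 'cV[nat]_p) :
  discrete_measurable_fun f -> discrete_measurable_fun g ->
  discrete_measurable_fun (fun w => f w + g w).
Proof.
move=> mf mg; have := @discrete_measurable_bind _ _ f (fun u w => u + g w) mf.
by apply=> u A; exact: (mg [set v | A (u + v)]).
Qed.

Lemma discrete_measurable_sum (I : Type) (p : nat) (s : seq I)
    (f : I -> T -> 'cV[nat]_p) :
  (forall i, discrete_measurable_fun (f i)) ->
  discrete_measurable_fun (fun w => \sum_(i <- s) f i w).
Proof.
move=> mf; elim: s => [|i s IH].
  by under eq_fun => w do rewrite big_nil; exact: discrete_measurable_cst.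
by under eq_fun => w do rewrite big_cons; exact: discrete_measurable_add.
Qed.

End DiscreteMeasurable.

(** * Supports and means of random vectors *)

Section Support.
Context {d : measure_display} {T : measurableType d} {R : realType}.
Context {P : probability T R} {p : nat}.
Implicit Types Y Z : {RV P >-> 'cV[nat]_p}.

Lemma discrete_measurable_RV Y : discrete_measurable_fun Y.
Proof. by move=> A; rewrite -[_ @^-1` _]setTI; exact: measurable_funP. Qed.

(** This extracts a concrete sample point from statements about probabilities. *)
Lemma positive_meets_ae (A : set T) (Q : T -> Prop) :
  measurable A -> (0 < P A)%E -> {ae P, forall w, Q w} ->
  exists2 w, A w & Q w.
Proof.
move=> mA PA Qae; apply: contrapT => AQ.
have /(measure_negligible mA) A0 : P.-negligible A.
  by apply: negligibleS Qae => w Aw /= Qw; apply: AQ; exists w.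
by rewrite A0 ltxx in PA.
Qed.

Definition supp Y : set 'cV[nat]_p := [set v | (0 < P (Y @^-1` [set v]))%E].

Lemma ae_suppP Y (Q : 'cV[nat]_p -> Prop) :
  {ae P, forall w, Q (Y w)} <-> forall v, supp Y v -> Q v.
Proof.
split=> [Qae v Sv|Qv].
  have [|w <- //] := positive_meets_ae _ Sv Qae.
  exact: discrete_measurable_RV.
(* The exceptional event is a countable union over codes n of vectors; a vector violating Q lies
   outside the support, so its fibre is null. *)
have H n : P.-negligible [set w | unpickle n = Some (Y w) /\ ~ Q (Y w)].
  case: (unpickle n) => [v|]; last first.
    by apply: negligibleS (negligible_set0 P) => w [].
  have [/Qv Qv'|] := pselect (supp Y v).
    by apply: negligibleS (negligible_set0 P) => w [[<-]].
  move=> /negP; rewrite -leNgt => Pv0.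
  apply: (@negligibleS _ _ _ _ (Y @^-1` [set v])) => [w [[->]]//|].
  apply/(negligibleP P); first exact: discrete_measurable_RV.
  by apply/eqP; rewrite eq_le Pv0 measure_ge0.
apply: negligibleS (negligible_bigcup H) => w /= nQ.
by exists (pickle (Y w)) => //=; rewrite pickleK.
Qed.

Lemma supp_nonempty Y : exists v, supp Y v.
Proof.
apply: contrapT => S0.
have : {ae P, forall w : T, False}.
  by apply/(ae_suppP Y (fun=> False)) => v Sv; apply: S0; exists v.
move=> /(positive_meets_ae measurableT)-/(_ _)[|//].
by rewrite probability_setT.
Qed.

Lemma same_law_supp Y Z : same_law Y Z -> supp Y = supp Z.
Proof.
move=> YZ; apply/funext => v.
by rewrite /supp/= -[P _]/(distribution P Y _) YZ.
Qed.

Lemma probability1_suppP Y (Q : set 'cV[nat]_p) :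
  P [set w | Q (Y w)] = 1%E <-> forall v, supp Y v -> Q v.
Proof.
have mQ := discrete_measurable_RV Y Q.
rewrite -ae_suppP; split => [Q1|Qae].
  apply/(negligibleP P); first exact: measurableC.
  by have := probability_setC P mQ; rewrite [P (Y @^-1` Q)]Q1 subee.
have := probability_setC P (measurableC mQ).
by rewrite setCK (measure_negligible (measurableC mQ) Qae) sube0.
Qed.

Lemma mean_coord_ge0 Y j : (0 <= mean_coord Y j)%E.
Proof. by apply: expectation_ge0 => w; rewrite ler0n. Qed.

Lemma mean_coord_measurable Y j :
  measurable_fun setT (fun w => ((Y w j 0)%:R : R)%:E : \bar R).
Proof.
move=> _ B mB; rewrite setTI.
exact: (discrete_measurable_RV Y [set v | B ((v j 0)%:R : R)%:E]).
Qed.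

Lemma mean_coord_abse Y j :
  mean_coord Y j = (\int[P]_w `|((Y w j 0)%:R : R)%:E|)%E.
Proof.
rewrite /mean_coord unlock; apply: eq_integral => w _.
by rewrite gee0_abs// lee_fin ler0n.
Qed.

Lemma mean_coord_integrable Y j : (mean_coord Y j < +oo)%E ->
  P.-integrable setT (fun w => ((Y w j 0)%:R : R)%:E).
Proof.
move=> fY; apply/integrableP; split; first exact: mean_coord_measurable.
by rewrite -mean_coord_abse.
Qed.

(** A nonnegative variable with zero integral vanishes almost everywhere. Finiteness matters because
    [fine] also sends +oo to 0. *)
Lemma mean_coord_eq0 Y j : (mean_coord Y j < +oo)%E ->
  fine (mean_coord Y j) = 0 <-> forall v, supp Y v -> v j 0 = 0%N.
Proof.
move=> fY.
have -> : fine (mean_coord Y j) = 0 <-> mean_coord Y j = 0%E.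
  split=> [Y0|->//]; rewrite -[LHS]fineK ?Y0// ge0_fin_numE// mean_coord_ge0//.
rewrite -ae_suppP.
have := ae_eq_integral_abs P measurableT (mean_coord_measurable Y j).
rewrite mean_coord_abse => -[H1 H2]; split=> [Y0|Y0].
  by apply: filterS (H1 Y0) => w /(_ I)[]/eqP; rewrite pnatr_eq0 => /eqP.
by apply: H2; apply: filterS Y0 => w Yw _ /=; rewrite Yw.
Qed.

(** Linearity of expectation, applied to the almost surely constant variable c.Y. For offspring
    vectors it identifies the constant as an entry of M c. *)
Lemma mean_dotp Y (c : 'cV[R]_p) (a : R) :
  (forall j, mean_coord Y j < +oo)%E ->
  (forall v, supp Y v -> dotp c (real_vec R v) = a) ->
  \sum_j fine (mean_coord Y j) * c j 0 = a.
Proof.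
move=> fY ca.
have intY j := mean_coord_integrable (fY j).
have : (\int[P]_w (\sum_j (c j 0)%:E * ((Y w j 0)%:R)%:E) = a%:E)%E.
  transitivity (\int[P]_w (cst a%:E w))%E; last first.
    by rewrite integral_cst// -[RHS]mule1; congr (_ * _)%E; exact: probability_setT.
  apply: ae_eq_integral => //.
  - apply: emeasurable_sum => j; apply: measurable_funeM.
    exact: mean_coord_measurable.
  - have /ae_suppP := ca; apply: filterS => w + _ => <-.
    rewrite /dotp mxE -sumEFin; apply: eq_bigr => j _.
    by rewrite !mxE EFinM.
rewrite integral_sum//; last by move=> j; exact: integrableZl.
move=> H; apply: EFin_inj; rewrite -H -sumEFin; apply: eq_bigr => j _.
rewrite integralZl// mulrC EFinM fineK; first by rewrite /mean_coord unlock.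
by rewrite ge0_fin_numE ?mean_coord_ge0.
Qed.

End Support.

(** * Paths of the process *)

Definition next_generation {p : nat} (f : 'I_p -> nat -> 'cV[nat]_p)
    (e x : 'cV[nat]_p) : 'cV[nat]_p :=
  \sum_(i < p) \sum_(k < x i 0) f i k + e.

Fixpoint trajectory {p : nat} (f : nat -> 'I_p -> nat -> 'cV[nat]_p)
    (e : nat -> 'cV[nat]_p) (x : 'cV[nat]_p) (n : nat) : 'cV[nat]_p :=
  if n is m.+1 then next_generation (f m) (e m) (trajectory f e x m) else x.

Lemma eq_next_generation (p : nat) (f f' : 'I_p -> nat -> 'cV[nat]_p)
    (e x : 'cV[nat]_p) :
  (forall i k, (k < x i 0%R)%N -> f i k = f' i k) ->
  next_generation f e x = next_generation f' e x.
Proof.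
move=> ff'; congr (_ + _); apply: eq_bigr => i _; apply: eq_bigr => k _.
exact: ff'.
Qed.

Lemma eq_trajectory (p : nat) (f f' : nat -> 'I_p -> nat -> 'cV[nat]_p)
    (e e' : nat -> 'cV[nat]_p) (x : 'cV[nat]_p) (n : nat) :
  (forall m, (m < n)%N -> f m = f' m /\ e m = e' m) ->
  trajectory f e x n = trajectory f' e' x n.
Proof.
elim: n => //= n IH ff'; have [-> ->] := ff' n (ltnSn n).
by rewrite IH// => m mn; apply: ff'; exact: ltnW.
Qed.

Section Process.
Context {d : measure_display} {T : measurableType d} {R : realType}.
Context {P : probability T R} {p : nat}.
Variable X : galton_watson P p.

Definition offspring_supp (i : 'I_p) : set 'cV[nat]_p :=
  supp (offspring X i 0%N 0%N).

Definition innovation_supp : set 'cV[nat]_p := supp (innovation X 0%N).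

(** A purely combinatorial form of a one-step transition of positive probability;
    [transition_prob_gt0P] links its iterates to the process. *)
Definition step (x y : 'cV[nat]_p) : Prop :=
  exists f e, [/\ forall i k, offspring_supp i (f i k), innovation_supp e
                & y = next_generation f e x].

Fixpoint reach (n : nat) (x y : 'cV[nat]_p) : Prop :=
  if n is m.+1 then exists2 z, reach m x z & step z y else x = y.

Lemma reach_trans m n x y z : reach m x y -> reach n y z -> reach (m + n) x z.
Proof.
move=> xy; elim: n z => [z <-|n IH z [u yu uz]]; first by rewrite addn0.
by rewrite addnS; exists u => //; exact: IH.
Qed.

Lemma offspring_supp_choice :
  exists g : 'I_p -> 'cV[nat]_p, forall i, offspring_supp i (g i).
Proof.
have [g gS] := choice (fun i => supp_nonempty (offspring X i 0%N 0%N)).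
by exists g.
Qed.

Lemma step_exists x : exists y, step x y.
Proof.
have [g gS] := offspring_supp_choice.
have [e eS] := supp_nonempty (innovation X 0%N).
by exists (next_generation (fun i _ => g i) e x), (fun i _ => g i), e.
Qed.

Lemma ae_in_supp : {ae P, forall w,
  (forall i n k, offspring_supp i (offspring X i n k w)) /\
  (forall n, innovation_supp (innovation X n w))}.
Proof.
have Ho : {ae P, forall w,
    forall n k i, offspring_supp i (offspring X i n k w)}.
  apply: ae_foralln => n; apply: ae_foralln => k; apply: filter_forall => i.
  apply/(ae_suppP (offspring X i n k)) => v.
  by rewrite (same_law_supp (offspring_same_law X i n k)).
have He : {ae P, forall w, forall n, innovation_supp (innovation X n w)}.
  apply: ae_foralln => n; apply/(ae_suppP (innovation X n)) => v.
  by rewrite (same_law_supp (innovation_same_law X n)).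
by apply: filterS2 Ho He => w Ho He; split.
Qed.

Lemma gw_reach x n w :
  (forall i n k, offspring_supp i (offspring X i n k w)) ->
  (forall n, innovation_supp (innovation X n w)) ->
  reach n x (gw_from X (cst x) n w).
Proof.
move=> Ho He; elim: n => //= n IH; exists (gw_from X (cst x) n w) => //.
by exists (fun i k => offspring X i n k w), (innovation X n w).
Qed.

Lemma gw_from_measurable x n : discrete_measurable_fun (gw_from X (cst x) n).
Proof.
elim: n => [|n IH]; first exact: discrete_measurable_cst.
have := @discrete_measurable_bind _ _ _ _ (gw_from X (cst x) n) (fun u w =>
  next_generation (fun i k => offspring X i n k w) (innovation X n w) u) IH.
apply=> u; apply: discrete_measurable_add; last exact: discrete_measurable_RV.
apply: discrete_measurable_sum => i; apply: discrete_measurable_sum => k.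
exact: discrete_measurable_RV.
Qed.

Lemma reach_trajectory n x y : reach n x y ->
  exists f e, [/\ forall m i k, offspring_supp i (f m i k),
    forall m, innovation_supp (e m) & trajectory f e x n = y].
Proof.
elim: n y => [y <-|n IH y [z /IH[f [e [fS eS fez]]] [f' [e' [fS' eS' ->]]]]].
  have [g gS] := offspring_supp_choice.
  have [e eS] := supp_nonempty (innovation X 0%N).
  by exists (fun _ i _ => g i), (fun=> e).
exists (fun m => if m == n then f' else f m).
exists (fun m => if m == n then e' else e m); split => [m|m|].
- by case: ifP.
- by case: ifP.
- rewrite /= eqxx -fez; congr next_generation.
  by apply: eq_trajectory => m mn; rewrite ltn_eqF.
Qed.

Lemma independent_supp_gt0 (J : seq (unit + 'I_p * nat * nat + nat))
    (v : unit + 'I_p * nat * nat + nat -> 'cV[nat]_p) :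
  let F := gw_family (init X) (offspring X) (innovation X) in
  uniq J -> {in J, forall s, supp (F s) (v s)} ->
  (0 < P (\bigcap_(s in [set` J]) (F s @^-1` [set v s])))%E.
Proof.
move=> F uJ vS; rewrite (gw_independent X (A := fun s => [set v s]) uJ)//.
rewrite big_seq; apply: (big_ind (fun y => (0 < y)%E)) => [|y z|s sJ].
- exact: lte01.
- exact: mule_gt0.
- exact: vS.
Qed.

(** An event of positive probability contains a sample point at which every variable lies in its
    support, which yields a path. Conversely, a path prescribes the values of finitely many
    independent variables, each value having positive probability. *)
Lemma transition_prob_gt0P n x y :
  (0 < transition_prob X n x y)%E <-> reach n x y.
Proof.
have mE : measurable [set w | gw_from X (cst x) n w = y].
  exact: (gw_from_measurable x n [set y]).
split=> [|/reach_trajectory[f [e [fS eS fey]]]].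
  move=> /(positive_meets_ae mE)/(_ ae_in_supp)[w /= <- [Ho He]].
  exact: gw_reach.
(* K bounds the number of individuals of each type in the generations before n, so the finite list J
   contains every variable that the path uses. *)
pose K := (\max_(m < n) \max_i trajectory f e x m i 0%R)%N.
pose J := undup ([seq inl (inr (t.1.1, val t.1.2, val t.2)) |
                   t <- enum {: 'I_p * 'I_n * 'I_K}] ++
                 [seq inr (val m) | m <- enum 'I_n])
  : seq (unit + 'I_p * nat * nat + nat).
pose v (s : unit + 'I_p * nat * nat + nat) := match s with
  | inl (inl _) => x | inl (inr (i, m, k)) => f m i k | inr m => e m end.
have := @independent_supp_gt0 J v (undup_uniq _).
set E := \bigcap_(s in _) _ => Epos.
have mEE : measurable E.
  apply: fin_bigcap_measurable; first exact: finite_seq.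
  by move=> s _; exact: discrete_measurable_RV.
apply: lt_le_trans (le_measure P (mem_set mEE) (mem_set mE) _).
  apply: Epos => s; rewrite mem_undup mem_cat => /orP[]/mapP[t _ ->] /=.
    by rewrite (same_law_supp (offspring_same_law X _ _ _)); exact: fS.
  by rewrite (same_law_supp (innovation_same_law X _)); exact: eS.
move=> w Ew /=; rewrite -fey.
have {}Ew s : s \in J ->
  gw_family (init X) (offspring X) (innovation X) s w = v s := Ew s.
suff H m : (m <= n)%N -> gw_from X (cst x) m w = trajectory f e x m by exact: H.
elim: m => [//|m IH mn]; rewrite [LHS]/= IH 1?ltnW//.
have -> : innovation X m w = e m.
  suff /Ew : inr m \in J by [].
  rewrite mem_undup mem_cat; apply/orP; right.
  by apply/mapP; exists (Ordinal mn) => //; rewrite mem_enum.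
apply: (@eq_next_generation _ (fun i k => offspring X i m k w)) => i k kx.
have kK : (k < K)%N.
  apply: leq_trans kx _; rewrite /K.
  apply: leq_trans (leq_bigmax (Ordinal mn)).
  exact: (@leq_bigmax _ (fun i => trajectory f e x m i 0%R) i).
suff /Ew : inl (inr (i, m, k)) \in J by [].
rewrite mem_undup mem_cat; apply/orP; left; apply/mapP.
by exists (i, Ordinal mn, Ordinal kK) => //; rewrite mem_enum.
Qed.

Lemma accessibleP x y : accessible X x y <-> exists n, reach n x y.
Proof. by split=> -[n /transition_prob_gt0P]; exists n. Qed.

(* Replacing an event on X_0 by the whole space or the empty set turns the
   independence of (X_0, xi, eta) into that of (x, xi, eta). *)
Lemma restart_independent x :
  mutually_independent (gw_family (cst x) (offspring X) (innovation X)).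
Proof.
move=> J A uJ mA.
pose A' s := if s is inl (inl _) then [set _ | A s x] else A s.
have E s : gw_family (cst x) (offspring X) (innovation X) s @^-1` A s =
    gw_family (init X) (offspring X) (innovation X) s @^-1` A' s.
  by case: s => [[[]|[[i n] k]]|n].
under eq_bigcapr do rewrite E; under eq_bigr do rewrite E.
by apply: (gw_independent X).
Qed.

Definition restart x : galton_watson P p :=
  GaltonWatson (restart_independent x) (offspring_same_law X)
    (innovation_same_law X) (offspring_finite_mean X).

Lemma gw_process_restart x n w :
  gw_process (restart x) n w = gw_from X (cst x) n w.
Proof. by rewrite /gw_process; elim: n => //= n ->. Qed.

(** The hypothesis is applied to the process restarted at x, on the same probability space; a sample
    path that hits C gives the path. *)
Lemma reached_from_everywhere C : reached_from_any_initial_law X C ->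
  forall x, exists n, exists2 y, C y & reach n x y.
Proof.
move=> /(_ d T P (restart _)) CX x.
have mE : measurable [set w | exists n, C (gw_from X (cst x) n w)].
  rewrite (_ : [set w | _] = \bigcup_n (gw_from X (cst x) n @^-1` C)).
    by apply: bigcupT_measurable => n; exact: gw_from_measurable.
  by apply/seteqP; split => w [n]; exists n.
have PE : (0 < P [set w | exists n, C (gw_from X (cst x) n w)])%E.
  have := CX x (fun _ _ _ => erefl) (fun _ _ => erefl).
  under eq_fun => w do under eq_exists => n do rewrite gw_process_restart.
  by move=> ->.
have [w [n Cw] [Ho He]] := positive_meets_ae mE PE ae_in_supp.
by exists n, (gw_from X (cst x) n w) => //; exact: gw_reach.
Qed.

End Process.

(** * Normal vectors of the communication class *)

Section DotProduct.
Context {R : realType} {p : nat}.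
Implicit Types (c x y : 'cV[R]_p).

Lemma dotpE c x : dotp c x = \sum_j c j 0 * x j 0.
Proof. by rewrite /dotp mxE; apply: eq_bigr => j _; rewrite mxE. Qed.

Lemma dotpC c x : dotp c x = dotp x c.
Proof. by rewrite !dotpE; apply: eq_bigr => j _; rewrite mulrC. Qed.

Lemma dotpB c x y : dotp c (x - y) = dotp c x - dotp c y.
Proof. by rewrite /dotp mulmxBr !mxE. Qed.

Lemma dotp_delta i x : dotp (delta_mx i 0) x = x i 0.
Proof.
rewrite dotpE (bigD1 i)//= mxE !eqxx mul1r big1 ?addr0// => j /negPf ji.
by rewrite mxE ji mul0r.
Qed.

Lemma dotp_next_generation c (f : 'I_p -> 'cV[nat]_p) (e x : 'cV[nat]_p) :
  dotp c (real_vec R (next_generation (fun i _ => f i) e x)) =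
  \sum_i (x i 0)%:R * dotp c (real_vec R (f i)) + dotp c (real_vec R e).
Proof.
rewrite /next_generation /real_vec map_mxD /dotp mulmxDr mxE; congr (_ + _).
rewrite map_mx_sum mulmx_sumr summxE; apply: eq_bigr => i _.
rewrite map_mx_sum mulmx_sumr summxE sumr_const card_ord.
by rewrite mulr_natl.
Qed.

Lemma dotp_next_generation0 c (f : 'I_p -> nat -> 'cV[nat]_p)
    (e x : 'cV[nat]_p) : (forall i k, dotp c (real_vec R (f i k)) = 0) ->
  dotp c (real_vec R (next_generation f e x)) = dotp c (real_vec R e).
Proof.
move=> f0; rewrite /next_generation /real_vec map_mxD /dotp mulmxDr mxE.
rewrite -[RHS]add0r; congr (_ + _).
rewrite map_mx_sum mulmx_sumr summxE big1// => i _.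
by rewrite map_mx_sum mulmx_sumr summxE big1// => k _; exact: f0.
Qed.

Lemma hyperplane_in_lower_dim_affine (D : set 'cV[R]_p) c (a : R) :
  c != 0 -> D `<=` [set x | dotp c x = a] -> in_lower_dim_affine D.
Proof.
(* For empty D the zero space suffices: c <> 0 forces p > 0. Otherwise the subspace passes through
   x0 with direction the kernel of x |-> c.x. *)
move=> c0 Dc; have [[x0 Dx0]|D0] := pselect (exists x, D x); last first.
  exists 0, 0%VS; split; last by move=> x Dx; case: D0; exists x.
  rewrite dimv0 lt0n; apply: contra_neq c0 => p0.
  by apply/colP => -[i ip]; exfalso; rewrite p0 in ip.
pose phi := linfun (mulmx c^T : 'cV[R]_p -> 'M[R]_1).
exists x0, (lker phi); split.
  have pE : \dim {: 'cV[R]_p} = p by rewrite dimvf /dim/= muln1.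
  have kerle : (\dim (lker phi) <= p)%N.
    by apply: leq_trans (dimvS (subvf _)) _; rewrite pE.
  rewrite ltn_neqAle kerle andbT.
  apply: contra_neq c0 => kerp.
  have kerT : lker phi = fullv.
    by apply/eqP; rewrite -(geq_leqif (dimv_leqif_eq (subvf _))) kerp pE.
  apply/colP => i; rewrite mxE.
  have : delta_mx i 0 \in lker phi by rewrite kerT memvf.
  rewrite memv_ker lfunE/= => /eqP/matrixP/(_ 0 0); rewrite [RHS]mxE => <-.
  by rewrite -[LHS]dotp_delta dotpC.
move=> x Dx; rewrite /affine_subspace/= memv_ker lfunE/=.
apply/eqP/matrixP => i j; rewrite !ord1.
have := dotpB c x x0; rewrite /dotp => ->; rewrite [RHS]mxE.
by have := Dc _ Dx; have := Dc _ Dx0; rewrite /= /dotp => -> ->; rewrite subrr.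
Qed.

(** The matrix whose rows form a basis of the direction V has rank below p, so it kills a nonzero
    column c, which is orthogonal to V. *)
Lemma lower_dim_affine_normal (D : set 'cV[R]_p) : in_lower_dim_affine D ->
  exists2 c : 'cV[R]_p, c != 0 & forall x y, D x -> D y -> dotp c x = dotp c y.
Proof.
move=> [a [V [Vp DV]]].
pose B := \matrix_(i < \dim V) (((vbasis V)`_i)^T).
have [c c0 Bc] := exists_kernel_col (leq_ltn_trans (rank_leq_row B) Vp).
have Vc v : v \in V -> dotp c v = 0.
  move=> /coord_vbasis ->; rewrite /dotp mulmx_sumr summxE big1// => i _.
  rewrite -scalemxAr mxE.
  suff -> : (c^T *m (vbasis V)`_i) 0 0 = 0 by rewrite mulr0.
  have := congr1 (fun M : 'cV[R]__ => M i 0) Bc.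
  rewrite -[LHS]/((B *m c) i 0) [RHS]mxE => <-.
  rewrite -[LHS]/(dotp _ _) dotpC /dotp [LHS]mxE [RHS]mxE.
  by apply: eq_bigr => j _; rewrite !mxE.
exists c => // x y /DV/Vc; rewrite dotpB => /subr0_eq -> /DV/Vc.
by rewrite dotpB => /subr0_eq ->.
Qed.

(** Being constant on D means being orthogonal to all differences of points of D; these are
    rational, so [integer_relation] applies. *)
Lemma integer_normal (D : set 'cV[nat]_p) c : c != 0 ->
  (forall x y : 'cV[nat]_p, D x -> D y ->
    dotp c (real_vec R x) = dotp c (real_vec R y)) ->
  exists c', [/\ c' != 0, forall i, c' i 0 \is a Num.int &
    forall x y : 'cV[nat]_p, D x -> D y ->
      dotp c' (real_vec R x) = dotp c' (real_vec R y)].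
Proof.
move=> c0 Dc; pose Q (x : 'cV[nat]_p) : 'cV[rat]_p := map_mx (fun m => m%:R) x.
have QE (x : 'cV[nat]_p) : map_mx ratr (Q x) = real_vec R x.
  by apply/colP => i; rewrite !mxE ratr_nat.
pose D' : set 'cV[rat]_p := [set v |
  exists x y : 'cV[nat]_p, [/\ D x, D y & v = Q x - Q y]].
have [|c' [c'0 c'int Dc']] := @integer_relation _ _ D' c c0.
  move=> _ [x [y [Dx Dy ->]]]; rewrite map_mxB !QE.
  apply/matrixP => i j; rewrite !ord1 [RHS]mxE.
  by rewrite -[LHS]/(dotp _ _) dotpC dotpB (Dc x y)// subrr.
exists c'; split=> // x y Dx Dy; apply: subr0_eq; rewrite -dotpB dotpC.
rewrite -!QE -map_mxB /dotp Dc' ?mxE//; by exists x, y.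
Qed.

End DotProduct.

(** * Invariance of the class and the types present in it *)

Section Class.
Context {d : measure_display} {T : measurableType d} {R : realType}.
Context {P : probability T R} {p : nat}.
Variable X : galton_watson P p.
Variable C : set 'cV[nat]_p.
Hypothesis classC : communication_class X C.
Hypothesis reachedC : reached_from_any_initial_law X C.

Let M := mean_matrix X.

(** A path from x hits C at some z, which leads to the representative x0 of the class and from there
    to y. *)
Lemma class_reachable x y : C y -> exists n, reach X n x y.
Proof.
case: classC => x0 CE; rewrite CE => -[/accessibleP[m x0y] _].
have [n [z]] := reached_from_everywhere reachedC x.
rewrite CE => -[_ /accessibleP[k zx0]] xz.
by exists (n + k + m)%N; exact: reach_trans (reach_trans xz zx0) x0y.
Qed.

Lemma class_step_closed x y : C x -> step X x y -> C y.
Proof.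
case: classC => x0 CE; rewrite [in X in X -> _]CE => -[/accessibleP[m x0x] _] xy.
rewrite CE; split; first by apply/accessibleP; exists m.+1, x.
apply/accessibleP/class_reachable; rewrite CE.
by split; apply/accessibleP; exists 0%N.
Qed.

Lemma class_reach_closed n x y : C x -> reach X n x y -> C y.
Proof.
by move=> Cx; elim: n y => [y <-//|n IH y [z /IH]]; exact: class_step_closed.
Qed.

Lemma class_nonempty : exists x, C x.
Proof.
by have [n [y Cy _]] := reached_from_everywhere reachedC 0; exists y.
Qed.

(** Step from some x in C to z, then follow a path from z to y. The initial step ensures positive
    length, and the path stays in C, so its last step is the one sought. *)
Lemma class_predecessor y : C y -> exists2 x, C x & step X x y.
Proof.
move=> Cy; have [x Cx] := class_nonempty; have [z xz] := step_exists X x.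
have Cz := class_step_closed Cx xz.
have [[zy|n [u zu uy]]] := class_reachable z Cy; first by exists x; rewrite -?zy.
by exists u => //; exact: class_reach_closed Cz zu.
Qed.

Lemma class_sub_invariant (D : set 'cV[nat]_p) :
  (exists x, D x) -> (forall x y, D x -> step X x y -> D y) -> C `<=` D.
Proof.
move=> [x Dx] Dstep y /(class_reachable x)[n].
by elim: n y => [y <-//|n IH y [z /IH]]; exact: Dstep.
Qed.

Lemma mean_matrixE i j : M i j = fine (mean_coord (offspring X i 0%N 0%N) j).
Proof. by rewrite mxE. Qed.

Lemma mean_matrix_ge0 i j : 0 <= M i j.
Proof. by rewrite mean_matrixE fine_ge0// mean_coord_ge0. Qed.

Lemma mean_matrix_exprS n i j :
  (M ^+ n.+1) i j = \sum_l M i l * (M ^+ n) l j.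
Proof. by rewrite exprS mxE. Qed.

Lemma mean_matrix_expr_ge0 n i j : 0 <= (M ^+ n) i j.
Proof.
elim: n i j => [|n IH] i j; first by rewrite expr0 mxE ler0n.
rewrite mean_matrix_exprS sumr_ge0// => l _.
by rewrite mulr_ge0// mean_matrix_ge0.
Qed.

Lemma mean_matrix_eq0 i j :
  M i j = 0 <-> forall v, offspring_supp X i v -> v j 0 = 0%N.
Proof.
by rewrite mean_matrixE; exact: mean_coord_eq0 (offspring_finite_mean X _ _ _ _).
Qed.

Lemma mean_matrix_dotp c i v :
  (forall u u', offspring_supp X i u -> offspring_supp X i u' ->
     dotp c (real_vec R u) = dotp c (real_vec R u')) ->
  offspring_supp X i v -> (M *m c) i 0 = dotp c (real_vec R v).
Proof.
move=> cS Sv; rewrite mxE.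
rewrite -(@mean_dotp _ _ _ _ _ (offspring X i 0%N 0%N) c (dotp c (real_vec R v))).
- by apply: eq_bigr => j _; rewrite mean_matrixE.
- exact: offspring_finite_mean.
- by move=> u Su; exact: cS.
Qed.

(** The states in which every type leading to i is absent include 0 and are closed under steps: such
    types never immigrate, and a parent that can beget one leads to i itself. *)
Lemma dies_out_class i : dies_out X i -> forall x, C x -> x i 0 = 0%N.
Proof.
move=> iX; pose leads j := exists n, 0 < (M ^+ n) j i.
suff /(_ _ _) CD : C `<=` [set x | forall j, leads j -> x j 0 = 0%N].
  by move=> x Cx; apply: (CD x Cx); exists 0%N; rewrite expr0 mxE eqxx ltr01.
apply: class_sub_invariant; first by exists 0 => j _; rewrite mxE.
move=> x _ xD [f [e [fS eS ->]]] j jl.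
rewrite mxE (_ : e j 0 = 0%N); last first.
  have [+ _] := probability1_suppP (innovation X 0%N) (fun v => v j 0 = 0%N).
  by apply; first exact: iX.
rewrite summxE big1// => l _; rewrite summxE big1// => k _.
apply: (proj1 (mean_matrix_eq0 l j)) (fS l k); apply: contrapT => /eqP Mlj.
suff /xD xl0 : leads l by case: k => k; rewrite xl0.
case: jl => n nj; exists n.+1; rewrite mean_matrix_exprS (bigD1 j)//=.
rewrite ltr_pwDl//; last first.
  by apply: sumr_ge0 => q _; rewrite mulr_ge0 ?mean_matrix_ge0 ?mean_matrix_expr_ge0.
by rewrite mulr_gt0// lt_neqAle eq_sym Mlj mean_matrix_ge0.
Qed.

Lemma degenerate_direction_class c a :
  (forall i v, offspring_supp X i v -> dotp c (real_vec R v) = 0) ->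
  (forall v, innovation_supp X v -> dotp c (real_vec R v) = a) ->
  forall x, C x -> dotp c (real_vec R x) = a.
Proof.
move=> oc ic x /class_predecessor[y _ [f [e [fS eS ->]]]].
by rewrite dotp_next_generation0 ?ic// => i k; exact: oc.
Qed.

(** A positive entry of a power of M factors through a type l with M j l <> 0; such an l occurs in
    some possible offspring of type j, hence in C one step later. *)
Lemma class_type_propagates n j i : 0 < (M ^+ n) j i ->
  (exists2 x, C x & (0 < x j 0%R)%N) -> exists2 x, C x & (0 < x i 0%R)%N.
Proof.
elim: n j => [|n IH] j.
  by rewrite expr0 mxE; case: eqVneq => [->|_]//; rewrite ltxx.
rewrite mean_matrix_exprS => Mji [x Cx xj].
have [l Ml Mn] : exists2 l, M j l != 0 & (M ^+ n) l i != 0.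
  apply: contrapT => H; move: Mji; rewrite big1 ?ltxx// => l _.
  apply/eqP; rewrite mulf_eq0; apply/negPn/negP; rewrite negb_or => /andP[? ?].
  by apply: H; exists l.
apply: (IH l); first by rewrite lt_neqAle eq_sym Mn mean_matrix_expr_ge0.
have [v Sv vl] : exists2 v, offspring_supp X j v & v l 0 != 0%N.
  apply: contrapT => H; move/eqP: Ml; apply; apply/mean_matrix_eq0 => v Sv.
  by apply/eqP/negPn/negP => vl; apply: H; exists v.
have [g gS] := offspring_supp_choice X.
have [e eS] := supp_nonempty (innovation X 0%N).
pose f i' (_ : nat) := if i' == j then v else g i'.
exists (next_generation f e x).
  apply: class_step_closed Cx _; exists f, e.
  by split => // i' k; rewrite /f; case: eqP => [->|].
rewrite mxE ltn_addr// summxE (bigD1 j)//= ltn_addr// summxE.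
rewrite (bigD1 (Ordinal xj))//= ltn_addr// /f eqxx lt0n//.
Qed.

(** Were i absent from C, no type leading to i could immigrate: one such immigrant would put its
    type into C, and i would follow by propagation. *)
Lemma class_type_alive i : ~ dies_out X i -> exists2 x, C x & (0 < x i 0%R)%N.
Proof.
move=> iX; apply: contrapT => Ci; apply: iX => j [n Mji].
apply/(probability1_suppP (innovation X 0%N) (fun v => v j 0 = 0%N)) => e eS.
apply/eqP/negPn/negP => ej; apply: Ci; apply: (class_type_propagates Mji).
have [g gS] := offspring_supp_choice X; have [x Cx] := class_nonempty.
exists (next_generation (fun i' _ => g i') e x).
  by apply: class_step_closed Cx _; exists (fun i' _ => g i'), e.
by rewrite mxE ltn_addl// lt0n.
Qed.

Definition constant_on_class (c : 'cV[R]_p) : Prop :=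
  forall x y, C x -> C y -> dotp c (real_vec R x) = dotp c (real_vec R y).

(** * Normal vectors when no type dies out *)

Section Alive.
Hypothesis alive : forall i, ~ dies_out X i.

(** Giving all type-i individuals of a state x the offspring v' instead of v changes c.y, for the
    successor y in C, by x_i (c.v' - c.v), and x_i > 0. *)
Lemma constant_on_offspring c i v v' : constant_on_class c ->
  offspring_supp X i v -> offspring_supp X i v' ->
  dotp c (real_vec R v) = dotp c (real_vec R v').
Proof.
move=> cC Sv Sv'; have [x Cx xi] := class_type_alive (@alive i).
have [g gS] := offspring_supp_choice X.
have [e eS] := supp_nonempty (innovation X 0%N).
pose f u l := if l == i then u else g l.
have Cf u : offspring_supp X i u -> C (next_generation (fun l _ => f u l) e x).
  move=> Su; apply: class_step_closed Cx _; exists (fun l _ => f u l), e.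
  by split => // l k; rewrite /f; case: eqP => [->|].
have := cC _ _ (Cf _ Sv) (Cf _ Sv').
rewrite !dotp_next_generation => /addIr; rewrite (bigD1 i)//= [RHS](bigD1 i)//=.
have fg u : \sum_(l < p | l != i) (x l 0)%:R * dotp c (real_vec R (f u l)) =
    \sum_(l < p | l != i) (x l 0)%:R * dotp c (real_vec R (g l)).
  by apply: eq_bigr => l /negPf li; rewrite /f li.
rewrite !fg /f eqxx.
by move=> /addIr/mulfI; apply; rewrite pnatr_eq0 -lt0n.
Qed.

Lemma constant_on_innovation c v v' : constant_on_class c ->
  innovation_supp X v -> innovation_supp X v' ->
  dotp c (real_vec R v) = dotp c (real_vec R v').
Proof.
move=> cC Sv Sv'; have [x Cx] := class_nonempty.
have [g gS] := offspring_supp_choice X.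
have Cf u : innovation_supp X u -> C (next_generation (fun l _ => g l) u x).
  by move=> Su; apply: class_step_closed Cx _; exists (fun l _ => g l), u.
by have := cC _ _ (Cf _ Sv) (Cf _ Sv'); rewrite !dotp_next_generation => /addrI.
Qed.

(** With fixed offspring g and innovation e, the successor of x has c-value (M c).x + c.e, because
    c.g_i = (M c)_i. *)
Lemma constant_on_class_mean c : constant_on_class c -> constant_on_class (M *m c).
Proof.
move=> cC; have [g gS] := offspring_supp_choice X.
have [e eS] := supp_nonempty (innovation X 0%N).
have E x : C x -> dotp c (real_vec R (next_generation (fun l _ => g l) e x)) =
    dotp (M *m c) (real_vec R x) + dotp c (real_vec R e).
  rewrite dotp_next_generation => Cx; rewrite [dotp (M *m c) _]dotpC.
  rewrite [dotp (real_vec R x) _]dotpE; congr (_ + _).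
  apply: eq_bigr => i _; rewrite mxE; congr (_ * _).
  rewrite (mean_matrix_dotp _ (gS i))// => u u'; exact: constant_on_offspring.
have Cf x : C x -> C (next_generation (fun l _ => g l) e x).
  by move=> Cx; apply: class_step_closed Cx _; exists (fun l _ => g l), e.
move=> x y Cx Cy; have := cC _ _ (Cf _ Cx) (Cf _ Cy).
by rewrite !E// => /addIr.
Qed.

(** The entry (M c)_i is an actual value of c.xi_i, an integer combination of natural numbers, and
    not merely an average. *)
Lemma mean_integral c : constant_on_class c ->
  (forall i, c i 0 \is a Num.int) -> forall i, (M *m c) i 0 \is a Num.int.
Proof.
move=> cC cint i; have [g gS] := offspring_supp_choice X.
rewrite (mean_matrix_dotp _ (gS i)); last first.
  by move=> u u'; exact: constant_on_offspring.
by rewrite dotpE rpred_sum// => j _; rewrite rpredM// mxE rpred_nat.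
Qed.

Lemma degenerate_direction_exists : subcritical X ->
  in_lower_dim_affine (real_vec R @` C) -> exists c, degenerate_direction X c.
Proof.
move=> subX /lower_dim_affine_normal[c' c'0 c'C].
have [|c [c0 cint cC]] := @integer_normal _ _ C c' c'0.
  by move=> x y Cx Cy; apply: c'C; [exists x|exists y].
have powC n : constant_on_class (M ^+ n *m c) /\
    forall i, (M ^+ n *m c) i 0 \is a Num.int.
  elim: n => [|n [IHC IHint]]; first by rewrite expr0 mul1mx.
  rewrite exprS -mulmxA; split; first exact: constant_on_class_mean.
  exact: mean_integral.
have [n nc0] := integer_powers_eventually0 subX (fun n => (powC n).2).
(* The direction is the last nonzero iterate: its product with M vanishes, so its constant value on
   each offspring law is 0. *)
have [m m0 m1] : exists2 m, M ^+ m *m c != 0 & M ^+ m.+1 *m c = 0.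
  elim: n nc0 => [|n IH nc0].
    by rewrite expr0 mul1mx => /eqP; rewrite (negPf c0).
  by have [/IH//|?] := eqVneq (M ^+ n *m c) 0; exists n.
have [mC _] := powC m.
exists (M ^+ m *m c); split => // [i|].
  apply/(ae_suppP (offspring X i 0%N 0%N)
    (fun v => dotp _ (real_vec R v) = 0)) => v Sv.
  rewrite -(mean_matrix_dotp _ Sv).
    suff -> : M *m (M ^+ m *m c) = M ^+ m.+1 *m c by rewrite m1 mxE.
    by rewrite exprS -mulmxA.
  by move=> u u'; exact: constant_on_offspring.
have [e eS] := supp_nonempty (innovation X 0%N).
exists (dotp (M ^+ m *m c) (real_vec R e)).
apply/(ae_suppP (innovation X 0%N)
  (fun v => dotp _ (real_vec R v) = _)) => v Sv.
exact: constant_on_innovation.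
Qed.

End Alive.

End Class.

Theorem theorem3 (R : realType) (d : measure_display) (T : measurableType d)
    (P : probability T R) (p : nat) (X : galton_watson P p)
    (C : set 'cV[nat]_p) :
  (0 < p)%N ->
  subcritical X ->
  communication_class X C ->
  reached_from_any_initial_law X C ->
  [/\ in_lower_dim_affine (real_vec R @` C) <->
        (exists i : 'I_p, dies_out X i) \/
        (exists c : 'cV[R]_p, degenerate_direction X c),
      forall i : 'I_p, dies_out X i ->
        real_vec R @` C `<=` [set x | dotp (delta_mx i 0) x = 0]
    & forall c : 'cV[R]_p, degenerate_direction X c ->
        forall a : R,
          {ae P, forall w, dotp c (real_vec R (innovation X 0%N w)) = a} ->
          real_vec R @` C `<=` [set x | dotp c x = a]].
Proof.
move=> _ subX classC reachedC.
have diesC i : dies_out X i ->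
    real_vec R @` C `<=` [set x | dotp (delta_mx i 0) x = 0].
  move=> iX _ [x Cx <-] /=; rewrite dotp_delta mxE.
  by rewrite (dies_out_class classC reachedC iX Cx).
have degC c : degenerate_direction X c -> forall a,
    {ae P, forall w, dotp c (real_vec R (innovation X 0%N w)) = a} ->
    real_vec R @` C `<=` [set x | dotp c x = a].
  move=> [_ oc _] a ic _ [x Cx <-] /=.
  apply: (degenerate_direction_class classC reachedC) Cx => [i|].
    exact/(ae_suppP (offspring X i 0%N 0%N) (fun v => dotp c (real_vec R v) = 0)).
  exact/(ae_suppP (innovation X 0%N) (fun v => dotp c (real_vec R v) = a)).
split=> //; split=> [CV|[[i iX]|[c cX]]].
- have [?|alive] := pselect (exists i, dies_out X i); [by left|right].
  apply: (degenerate_direction_exists classC reachedC) => // i iX.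
  by apply: alive; exists i.
- apply: (hyperplane_in_lower_dim_affine _ (diesC i iX)).
  by apply/eqP => /colP/(_ i)/eqP; rewrite !mxE !eqxx oner_eq0.
- have [c0 _ [a ca]] := cX.
  exact: (hyperplane_in_lower_dim_affine c0 (degC c cX a ca)).
Qed.
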